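(* Let $\ell$ be a positive integer. Consider the following sets of maps $\mathbb{C}^{\mathbb{Z}_\ell}\times\mathbb{C}^{\mathbb{Z}_\ell}\to\mathbb{C}^{\mathbb{Z}_\ell}\times\mathbb{C}^{\mathbb{Z}_\ell}$, which are groups under function composition: (1) $G_1=\langle c_1\rangle\times\langle c_1\rangle$, consisting of the maps $(c_i,c_j):(\mathbf{u},\mathbf{v})\mapsto(c_i(\mathbf{u}),c_j(\mathbf{v}))$ for $i,j\in\mathbb{Z}_\ell$; (2) $G_2=\langle d_k\mid k\in\mathbb{Z}_\ell^\times\rangle\times\langle -1\rangle$, consisting of the maps $(d_k,(-1)^r):(\mathbf{u},\mathbf{v})\mapsto(d_k(\mathbf{u}),d_{(-1)^rk}(\mathbf{v}))$ for $k\in\mathbb{Z}_\ell^\times$, $r\in\{0,1\}$; (3) $G_3=\langle s\rangle$, where $s(\mathbf{u},\mathbf{v})=(\mathbf{v},\mathbf{u})$. Let $GG=\langle G_1,G_2,G_3\rangle$ be the group generated by these maps under function composition. Then $$GG\cong G_1\rtimes(G_2\rtimes G_3),$$ where both semidirect products are taken with respect to conjugation inside $GG$.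
   Context: $\mathbb{Z}_\ell$ is the ring of integers modulo $\ell$, $\mathbb{Z}_\ell^\times$ its multiplicative group of units, and $\mathbb{C}^{\mathbb{Z}_\ell}$ the set of complex vectors indexed by $\mathbb{Z}_\ell$. For $j\in\mathbb{Z}_\ell$, the cyclic shift $c_j:\mathbb{C}^{\mathbb{Z}_\ell}\to\mathbb{C}^{\mathbb{Z}_\ell}$ is $(c_j(\mathbf{v}))_i=v_{i-j}$. For $k\in\mathbb{Z}_\ell^\times$, the decimation $d_k:\mathbb{C}^{\mathbb{Z}_\ell}\to\mathbb{C}^{\mathbb{Z}_\ell}$ is $(d_k(\mathbf{v}))_i=v_{ik^{-1}}$. For groups $H,K$ and a homomorphism $\theta:K\to\mathrm{Aut}(H)$, $k\mapsto\theta_k$, the semidirect product $H\rtimes_\theta K$ is the set $H\times K$ with multiplication $(h_1,k_1)(h_2,k_2)=(h_1\theta_{k_1}(h_2),k_1k_2)$. The symbol $\rtimes$ without subscript means that $\theta$ is given by conjugation, $\theta_q(k)=qkq^{-1}$. Here $G_3$ acts on $G_2$ by conjugation in $GG$, and an element $(g_2,g_3)\in G_2\rtimes G_3$ acts on $G_1$ by conjugation by $g_2g_3$ in $GG$. *)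

(* Defs.v *)
From HB Require Import structures.
From mathcomp Require Import all_boot all_order all_algebra complex.
From mathcomp Require Import boolp classical_sets reals.

Set Implicit Arguments.
Unset Strict Implicit.
Unset Printing Implicit Defensive.

Import GRing.Theory.

Local Open Scope classical_set_scope.
Local Open Scope group_scope.

(* The permutations of an arbitrary type, as {perm T} needs a finType; the    *)
(* product f * g is f \o g, whereas in {perm T} it is g \o f.                 *)
Record sym (T : Type) := Sym {
  sym_fun :> T -> T;
  sym_inv : T -> T;
  sym_funK : cancel sym_fun sym_inv;
  sym_invK : cancel sym_inv sym_fun }.

Lemma symP (T : Type) (f g : sym T) : f =1 g -> f = g.
Proof.
case: f g => f f' fK f'K [g g' gK g'K] /= /funext fg.
rewrite {}fg in fK f'K *.
have fg' : f' = g' by apply/funext => x; rewrite -[x in f' x]g'K fK.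
rewrite {}fg' in fK f'K *.
by rewrite (Prop_irrelevance fK gK) (Prop_irrelevance f'K g'K).
Qed.

Section SymGroup.
Variable T : Type.
Implicit Types f g h : sym T.

Definition sym_one : sym T := @Sym T id id (fun=> erefl) (fun=> erefl).

Definition sym_mul f g : sym T :=
  @Sym T (f \o g) (sym_inv g \o sym_inv f)
    (can_comp (@sym_funK T f) (@sym_funK T g))
    (can_comp (@sym_invK T g) (@sym_invK T f)).

Definition sym_invg f : sym T := Sym (@sym_invK T f) (@sym_funK T f).

Lemma sym_mulA : associative sym_mul.
Proof. by move=> f g h; apply: symP. Qed.

Lemma sym_mul1g : left_id sym_one sym_mul.
Proof. by move=> f; apply: symP. Qed.

Lemma sym_mulg1 : right_id sym_one sym_mul.
Proof. by move=> f; apply: symP. Qed.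

Lemma sym_mulVg : left_inverse sym_one sym_invg sym_mul.
Proof. by move=> f; apply: symP => x /=; rewrite sym_funK. Qed.

Lemma sym_mulgV : right_inverse sym_one sym_invg sym_mul.
Proof. by move=> f; apply: symP => x /=; rewrite sym_invK. Qed.

HB.instance Definition _ := gen_eqMixin (sym T).
HB.instance Definition _ := gen_choiceMixin (sym T).
HB.instance Definition _ := isGroup.Build (sym T)
  sym_mulA sym_mul1g sym_mulg1 sym_mulVg sym_mulgV.

End SymGroup.

Record subgroup (G : groupType) := Subgroup {
  sgset : set G;
  sgset_closed : group_closed (mem sgset) }.

Definition sg_elt (G : groupType) (H : subgroup G) : Type :=
  {x : G | x \in sgset H}.

HB.instance Definition _ (G : groupType) (H : subgroup G) :=
  [isSub for (@sval _ _ : sg_elt H -> G)].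
HB.instance Definition _ (G : groupType) (H : subgroup G) :=
  [Choice of sg_elt H by <:].
HB.instance Definition _ (G : groupType) (H : subgroup G) :=
  SubChoice_isSubGroup.Build G (mem (sgset H)) (sg_elt H) (sgset_closed H).

Definition sg_group (G : groupType) (H : subgroup G) : groupType :=
  Group.clone (sg_elt H) _.
Coercion sg_group : subgroup >-> Group.type.

Lemma mult1 (G H : groupType) (f : {multiplicative G -> H}) : f 1 = 1.
Proof. by apply: (@mulgI _ (f 1)); rewrite -gmulfM !mulg1. Qed.

Lemma multV (G H : groupType) (f : {multiplicative G -> H}) x :
  f x^-1 = (f x)^-1.
Proof. by apply: (@mulgI _ (f x)); rewrite -gmulfM !mulgV mult1. Qed.

Definition isomorphic (G H : groupType) : Prop :=
  exists f : {multiplicative G -> H}, bijective f.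

Section Generated.
Variables (G : groupType) (A : set G).

Definition gen_set : set G :=
  smallest (fun B : set G => group_closed (mem B)) A.

Lemma gen_closed : group_closed (mem gen_set).
Proof.
split; first by rewrite inE => B [[B1 _] _]; rewrite inE in B1.
move=> x y; rewrite !inE => xA yA B [BG AB].
suff : x / y \in B by rewrite inE.
by apply: BG.2; rewrite inE; [apply: xA | apply: yA].
Qed.

Definition generated : subgroup G := Subgroup gen_closed.
End Generated.

Section Automorphisms.
Variable H : groupType.

Definition aut_set : set (sym H) :=
  [set f : sym H | forall x y, f (x * y) = f x * f y].

Lemma aut_closed : group_closed (mem aut_set).
Proof.
split; first by rewrite inE.
move=> f g; rewrite !inE => fM gM x y /=; rewrite -fM; congr (f _).
by apply: (can_inj (@sym_funK _ g)); rewrite gM !sym_invK.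
Qed.

Definition Aut : subgroup (sym H) := Subgroup aut_closed.
End Automorphisms.

Section SemidirectProduct.
Variables (H K : groupType) (theta : {multiplicative K -> Aut H}).

Let act (k : K) : H -> H := val (theta k).

Definition sdprod_type : Type := (H * K)%type.

Let actM k x y : act k (x * y) = act k x * act k y.
Proof. by have := valP (theta k); rewrite inE; apply. Qed.

Let act1 x : act 1 x = x.
Proof. by rewrite /act mult1. Qed.

Let actMl k k' x : act (k * k') x = act k (act k' x).
Proof. by rewrite /act gmulfM. Qed.

Let act_1 k : act k 1 = 1.
Proof. by apply: (@mulgI _ (act k 1)); rewrite -actM !mulg1. Qed.

Definition sdprod_one : sdprod_type := (1, 1).
Definition sdprod_mul (x y : sdprod_type) : sdprod_type :=
  (x.1 * act x.2 y.1, x.2 * y.2).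
Definition sdprod_inv (x : sdprod_type) : sdprod_type :=
  (act x.2^-1 x.1^-1, x.2^-1).

Lemma sdprod_mulA : associative sdprod_mul.
Proof.
by move=> x y z; rewrite /sdprod_mul /= actM actMl !mulgA.
Qed.

Lemma sdprod_mul1g : left_id sdprod_one sdprod_mul.
Proof. by case=> h k; rewrite /sdprod_mul /= act1 !mul1g. Qed.

Lemma sdprod_mulg1 : right_id sdprod_one sdprod_mul.
Proof. by case=> h k; rewrite /sdprod_mul /= act_1 !mulg1. Qed.

Lemma sdprod_mulVg : left_inverse sdprod_one sdprod_inv sdprod_mul.
Proof.
by case=> h k; rewrite /sdprod_mul /= -actM !mulVg act_1.
Qed.

Lemma sdprod_mulgV : right_inverse sdprod_one sdprod_inv sdprod_mul.
Proof.
by case=> h k; rewrite /sdprod_mul /= -actMl !mulgV act1 mulgV.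
Qed.

HB.instance Definition _ := Choice.on sdprod_type.
HB.instance Definition _ := isGroup.Build sdprod_type
  sdprod_mulA sdprod_mul1g sdprod_mulg1 sdprod_mulVg sdprod_mulgV.

Definition sdprod : groupType := Group.clone sdprod_type _.
End SemidirectProduct.

(* K need not be a subgroup of G: it acts through phi. This is what lets      *)
(* G2 ><| G3, a set of pairs, act on G1 by conjugation by g2 * g3.            *)
(* Note that conjg in the library is x ^ y = y^-1 * x * y, hence the explicit *)
(* formula.                                                                   *)
Section Conjugation.
Variables (G K : groupType) (phi : {multiplicative K -> G}) (N : subgroup G).

Definition normalises : Prop :=
  forall k x, x \in sgset N -> phi k * x * (phi k)^-1 \in sgset N.

Hypothesis nN : normalises.

Definition conj_fun (k : K) (x : N) : N :=
  exist _ (phi k * val x * (phi k)^-1) (nN k (valP x)).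

Lemma conj_funK k : cancel (conj_fun k) (conj_fun k^-1).
Proof.
move=> x; apply: val_inj.
by rewrite /= multV invgK !mulgA mulVg mul1g mulgVK.
Qed.

Lemma conj_funVK k : cancel (conj_fun k^-1) (conj_fun k).
Proof. by move=> x; rewrite -{1}[k]invgK conj_funK. Qed.

Definition conj_sym (k : K) : sym N :=
  Sym (conj_funK k) (conj_funVK k).

Lemma conj_sym_aut k : conj_sym k \in sgset (Aut N).
Proof.
by rewrite inE => x y; apply: val_inj; rewrite /= !mulgA mulgVK.
Qed.

Definition conj_act (k : K) : Aut N :=
  exist _ (conj_sym k) (conj_sym_aut k).

Lemma conj_actM : {morph conj_act : k k' / k * k'}.
Proof.
move=> k k'; apply: val_inj; apply: symP => x.
by apply: val_inj; rewrite /= gmulfM invgM !mulgA.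
Qed.

HB.instance Definition _ := isMultiplicative.Build K _ conj_act conj_actM.
End Conjugation.

Section InternalProduct.
Variables (G : groupType) (N K : subgroup G).

Definition normalised_by : Prop :=
  normalises (val : {multiplicative K -> G}) N.

Hypothesis nNK : normalised_by.

Definition conj_sdprod : groupType := sdprod (conj_act nNK).

Definition conj_sdprod_val (x : conj_sdprod) : G := val x.1 * val x.2.

Lemma conj_sdprod_valM : {morph conj_sdprod_val : x y / x * y}.
Proof.
by move=> x y; rewrite /conj_sdprod_val /= !mulgA mulgVK.
Qed.

HB.instance Definition _ :=
  isMultiplicative.Build conj_sdprod G conj_sdprod_val conj_sdprod_valM.
End InternalProduct.

Local Open Scope ring_scope.

(* Not 'Z_l, which is Z/2 when l = 1. For l > 0 this is 'I_l, and Zmod 1 is   *)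
(* the zero ring, hence only a "Pz" ring.                                     *)
Definition Zmod (l : nat) : Type := 'I_l.-1.+1.

Section ZmodRing.
Variable l : nat.
HB.instance Definition _ := GRing.Zmodule.on (Zmod l).
HB.instance Definition _ := Finite.on (Zmod l).
HB.instance Definition _ := GRing.Zmodule_isComPzRing.Build (Zmod l)
  (@Zp_mulA _) (@Zp_mulC _) (@Zp_mul1z _) (@Zp_mul_addl _).
End ZmodRing.

(* unitRingType requires 1 != 0, so the library has no units of Zmod l. The   *)
(* inverse is a field because it is unique and decim needs it.                *)
Record Zunit (l : nat) := ZUnit {
  zu_val : Zmod l;
  zu_inv : Zmod l;
  zu_mulV : zu_val * zu_inv = 1 }.

Section Units.
Variable l : nat.
Implicit Types k : Zunit l.

Lemma zu_one_subproof : 1 * 1 = 1 :> Zmod l.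
Proof. by rewrite mulr1. Qed.
Definition zu_one := ZUnit zu_one_subproof.

Lemma zu_mul_subproof k k' : (zu_val k * zu_val k') * (zu_inv k * zu_inv k') = 1.
Proof. by rewrite mulrACA !zu_mulV mulr1. Qed.
Definition zu_mul k k' := ZUnit (zu_mul_subproof k k').

Lemma zu_invg_subproof k : zu_inv k * zu_val k = 1.
Proof. by rewrite mulrC zu_mulV. Qed.
Definition zu_invg k := ZUnit (zu_invg_subproof k).

Lemma zu_sign_subproof (r : bool) k :
  ((-1) ^+ r * zu_val k) * ((-1) ^+ r * zu_inv k) = 1.
Proof. by rewrite mulrACA -signr_addb addbb zu_mulV mulr1. Qed.
Definition zu_sign (r : bool) k := ZUnit (zu_sign_subproof r k).
End Units.

Section Maps.
Variables (R : realType) (l : nat).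

Definition cvec : Type := {ffun Zmod l -> R[i]}.

Definition shift_fun (j : Zmod l) (v : cvec) : cvec := [ffun i => v (i - j)].

Lemma shift_funK j : cancel (shift_fun j) (shift_fun (- j)).
Proof. by move=> v; apply/ffunP => i; rewrite !ffunE opprK addrK. Qed.

Lemma shift_funVK j : cancel (shift_fun (- j)) (shift_fun j).
Proof. by move=> v; apply/ffunP => i; rewrite !ffunE opprK subrK. Qed.

Definition shift j : sym cvec := Sym (shift_funK j) (shift_funVK j).

Definition decim_fun (k : Zunit l) (v : cvec) : cvec :=
  [ffun i => v (i * zu_inv k)].

Lemma decim_funK k : cancel (decim_fun k) (decim_fun (zu_invg k)).
Proof.
by move=> v; apply/ffunP => i; rewrite !ffunE -mulrA zu_mulV mulr1.
Qed.

Lemma decim_funVK k : cancel (decim_fun (zu_invg k)) (decim_fun k).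
Proof.
by move=> v; apply/ffunP => i; rewrite !ffunE -mulrA zu_invg_subproof mulr1.
Qed.

Definition decim k : sym cvec := Sym (decim_funK k) (decim_funVK k).

Definition pair_fun (f g : cvec -> cvec) (w : cvec * cvec) : cvec * cvec :=
  (f w.1, g w.2).

Lemma pair_funK (f g : sym cvec) :
  cancel (pair_fun f g) (pair_fun (sym_inv f) (sym_inv g)).
Proof. by case=> u v; rewrite /pair_fun /= !sym_funK. Qed.

Lemma pair_funVK (f g : sym cvec) :
  cancel (pair_fun (sym_inv f) (sym_inv g)) (pair_fun f g).
Proof. by case=> u v; rewrite /pair_fun /= !sym_invK. Qed.

Definition pair_sym (f g : sym cvec) : sym (cvec * cvec) :=
  Sym (pair_funK f g) (pair_funVK f g).

Definition swap_fun (w : cvec * cvec) : cvec * cvec := (w.2, w.1).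

Lemma swap_funK : cancel swap_fun swap_fun. Proof. by case. Qed.

Definition swap : sym (cvec * cvec) := Sym swap_funK swap_funK.

Definition G1_set : set (sym (cvec * cvec)) :=
  [set f | exists i j : Zmod l, f = pair_sym (shift i) (shift j)].

Lemma G1_closed : group_closed (mem G1_set).
Proof.
split.
  rewrite inE; exists 0, 0; apply: symP => -[u v].
  by congr pair; apply/ffunP => i; rewrite ffunE subr0.
move=> f g; rewrite !inE => -[i [j ->]] [i' [j' ->]].
exists (i - i'), (j - j'); apply: symP => -[u v].
by congr pair; apply/ffunP => x; rewrite !ffunE opprB opprK addrA addrAC.
Qed.

Definition G1 : subgroup (sym (cvec * cvec)) := Subgroup G1_closed.

Definition G2_set : set (sym (cvec * cvec)) :=
  [set f | exists (k : Zunit l) (r : bool),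
             f = pair_sym (decim k) (decim (zu_sign r k))].

Lemma G2_closed : group_closed (mem G2_set).
Proof.
split.
  rewrite inE; exists (zu_one l), false; apply: symP => -[u v].
  by congr pair; apply/ffunP => i; rewrite ffunE /= ?expr0 ?mulr1.
move=> f g; rewrite !inE => -[k [r ->]] [k' [r' ->]].
exists (zu_mul k (zu_invg k')), (r (+) r'); apply: symP => -[u v].
congr pair; apply/ffunP => x; rewrite !ffunE /= ?mulrA //.
congr (v _); rewrite signr_addb -!mulrA; congr (_ * (_ * _)).
by rewrite mulrCA.
Qed.

Definition G2 : subgroup (sym (cvec * cvec)) := Subgroup G2_closed.

Definition G3 : subgroup (sym (cvec * cvec)) := generated [set swap].

Definition GG : subgroup (sym (cvec * cvec)) :=
  generated (sgset G1 `|` sgset G2 `|` sgset G3).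
End Maps.

(* Main.v *)
Require Import Defs.
From HB Require Import structures.
From mathcomp Require Import all_boot all_algebra complex.
From mathcomp Require Import boolp classical_sets reals.

(** Every element of [GG] is a product [g1 * (g2 * g3)] in exactly one way, and
    such products multiply as in the semidirect product.

    Existence: conjugation by [swap] exchanges the two components of a map, and
    conjugation by [d_k] turns the shift [c_i] into [c_(ik)]. Hence [G3]
    normalises [G2], and [G2] and [G3] normalise [G1]. The products
    [g1 * (g2 * g3)] are therefore the values of a homomorphism defined on
    [G1 ><| (G2 ><| G3)], so they form a group, which is the one generated by
    the three factors ([range_closed], [sgset_GG]).

    Uniqueness: it suffices that [g2 * g3] lies in [G1] only if [g2] and [g3]
    are trivial ([sdprod_val_inj]). A product [g2 * swap] sends the first
    argument to the second component, whereas [G1] acts on the two components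
    separately, so [g3 = 1] ([pair_sym_mul_swap]). Then in each component a
    shift equals a decimation; the decimation fixes the coordinate of index 0
    of every vector, so the shift is by 0 ([shift_eq_decim]). *)

Set Implicit Arguments.
Unset Strict Implicit.
Unset Printing Implicit Defensive.

Import GRing.Theory.

Local Open Scope classical_set_scope.
Local Open Scope group_scope.

Lemma range_closed (H G : groupType) (f : {multiplicative H -> G}) :
  group_closed (mem (range f)).
Proof.
split; first by rewrite inE; exists 1 => //; exact: mult1.
move=> x y; rewrite !inE => -[a _ <-] [b _ <-].
by exists (a / b) => //; rewrite gmulfM multV.
Qed.

Lemma isomorphic_range (H G : groupType) (f : {multiplicative H -> G})
    (K : subgroup G) :
  injective f -> sgset K = range f -> isomorphic K H.
Proof.
move=> f_inj Kf.
have pre (x : K) : exists a, f a = val x.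
  have /set_mem : val x \in sgset K := valP x.
  by move: (val x) => y; rewrite Kf => -[a _ <-]; exists a.
have [g gK] := choice pre.
have gM : {morph g : x y / x * y}.
  by move=> x y; apply: f_inj; rewrite gmulfM !gK.
pose gm := isMultiplicative.Build K H g gM.
pose h : {multiplicative K -> H} := HB.pack g gm.
exists h.
have fK a : f a \in sgset K by rewrite inE Kf; exists a.
exists (fun a => exist _ (f a) (fK a) : K) => [x | a].
  by apply: val_inj; rewrite /= gK.
by apply: f_inj; rewrite gK.
Qed.

Section SdprodVal.
Variables (G K : groupType) (phi : {multiplicative K -> G}) (N : subgroup G).
Hypothesis nN : normalises phi N.

Definition sdprod_val (x : sdprod (conj_act nN)) : G := val x.1 * phi x.2.

Lemma sdprod_valM : {morph sdprod_val : x y / x * y}.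
Proof. by move=> x y; rewrite /sdprod_val /= gmulfM !mulgA mulgVK. Qed.

HB.instance Definition _ :=
  isMultiplicative.Build (sdprod (conj_act nN)) G sdprod_val sdprod_valM.

(** Two equal products [n * phi k] and [n' * phi k'] give
    [phi (k / k') = n^-1 * n'], an element of [N]. *)
Lemma sdprod_val_inj :
  (forall k, phi k \in sgset N -> k = 1) -> injective sdprod_val.
Proof.
move=> phiN [n k] [n' k'] /= eq_nk.
have ek : phi (k / k') = val (n^-1 * n').
  apply: (@mulgI _ (val n)); apply: (@mulIg _ (phi k')).
  rewrite gmulfM multV !mulgA mulgVK (eq_nk : _ * _ = _ * _).
  by rewrite /= mulgV mul1g.
have {ek} /divg1_eq kk' : k / k' = 1 by apply: phiN; rewrite ek; exact: valP.
congr pair => //; apply: val_inj; apply: (@mulIg _ (phi k)).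
by rewrite (eq_nk : _ * _ = _ * _) kk'.
Qed.

End SdprodVal.

Section Maps.
Variables (R : realType) (l : nat).
Local Notation T := (cvec R l).

Lemma pair_symM (f g f' g' : sym T) :
  pair_sym f g * pair_sym f' g' = pair_sym (f * f') (g * g').
Proof. exact: symP. Qed.

Lemma pair_symV (f g : sym T) : (pair_sym f g)^-1 = pair_sym f^-1 g^-1.
Proof. exact: symP. Qed.

Lemma pair_sym1 : pair_sym 1 1 = 1 :> sym (T * T).
Proof. by apply: symP => -[]. Qed.

Lemma conj_swap (f g : sym T) :
  swap R l * pair_sym f g * (swap R l)^-1 = pair_sym g f.
Proof. exact: symP. Qed.

Lemma conj_decim_shift (k : Zunit l) (i : Zmod l) :
  decim R k * shift R i * (decim R k)^-1 = shift R (i * zu_val k)%R.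
Proof.
apply: symP => v; apply/ffunP => x; rewrite !ffunE /=; congr (v _).
by rewrite mulrBl -mulrA zu_invg_subproof mulr1.
Qed.

Lemma shift0 : shift R (0 : Zmod l)%R = 1.
Proof. by apply: symP => v; apply/ffunP => x; rewrite ffunE subr0. Qed.

Lemma decim_ext (k k' : Zunit l) : zu_inv k = zu_inv k' -> decim R k = decim R k'.
Proof. by move=> kk'; apply: symP => v; apply/ffunP => x; rewrite !ffunE kk'. Qed.

(** A decimation fixes the coordinate of index 0, so comparing the two maps on
    the indicator of 0 shows that the shift leaves index 0 in place. *)
Lemma shift_eq_decim (i : Zmod l) (k : Zunit l) :
  shift R i = decim R k -> shift R i = 1.
Proof.
pose v : T := [ffun x => (x == 0)%:R]%R.
move=> ik; have := congr1 (fun f : sym T => f v 0%R) ik.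
rewrite /= !ffunE mul0r eqxx sub0r oppr_eq0.
case: eqP => [-> _ | _ /eqP]; first exact: shift0.
by rewrite eq_sym oner_eq0.
Qed.

(** Otherwise [f b = f' a] for all vectors [a] and [b], which contradicts the
    injectivity of [f] since there are two different vectors. *)
Lemma pair_sym_mul_swap (f g f' g' : sym T) :
  pair_sym f g * swap R l <> pair_sym f' g'.
Proof.
pose a : T := [ffun=> 0%R]; pose b : T := [ffun=> 1%R].
move=> eq_fg; have fE x y : f y = f' x.
  exact (congr1 (fun h : sym (T * T) => (h (x, y)).1) eq_fg).
have /(can_inj (sym_funK f)) : f a = f b by rewrite !(fE a).
by move/ffunP/(_ 0%R); rewrite !ffunE => /eqP; rewrite eq_sym oner_eq0.
Qed.

Lemma swapV : (swap R l)^-1 = swap R l.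
Proof. exact: symP. Qed.

Lemma swapK : swap R l * swap R l = 1.
Proof. by apply: symP => -[]. Qed.

Lemma G3P f : f \in sgset (G3 R l) -> f = 1 \/ f = swap R l.
Proof.
rewrite inE; move: f; apply: smallest_sub; last by move=> f ->; right.
split; first by rewrite inE; left.
move=> f g; rewrite !inE => -[->|->] [->|->] /=;
  rewrite ?swapV ?swapK ?invg1 ?mul1g ?mulg1.
all: by [left | right].
Qed.

Lemma G3_normalises_G2 : normalised_by (G2 R l) (G3 R l).
Proof.
move=> [g gG3] f fG2 /=; case: (G3P gG3) => ->.
  by rewrite mul1g invg1 mulg1.
move: fG2; rewrite !inE => -[k [r ->]]; rewrite conj_swap.
(* (d_((-1)^r k), d_k) has the same sign r over the unit (-1)^r k. *)
exists (zu_sign r k), r; congr pair_sym; apply: decim_ext.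
by rewrite /= mulrA -signr_addb addbb mul1r.
Qed.

Lemma G2_normalises_G1 g f : g \in sgset (G2 R l) -> f \in sgset (G1 R l) ->
  g * f * g^-1 \in sgset (G1 R l).
Proof.
rewrite !inE => -[k [r ->]] [i [j ->]].
rewrite pair_symV !pair_symM !conj_decim_shift.
by exists (i * zu_val k)%R, (j * zu_val (zu_sign r k))%R.
Qed.

Lemma G3_normalises_G1 g f : g \in sgset (G3 R l) -> f \in sgset (G1 R l) ->
  g * f * g^-1 \in sgset (G1 R l).
Proof.
case/G3P => ->; first by rewrite mul1g invg1 mulg1.
by rewrite !inE => -[i [j ->]]; rewrite conj_swap; exists j, i.
Qed.

Local Notation val23 := (@conj_sdprod_val _ _ _ G3_normalises_G2).

Lemma G23_normalises_G1 : normalises val23 (G1 R l).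
Proof.
move=> [g2 g3] f fG1; rewrite /conj_sdprod_val /= invgM.
have -> : val g2 * val g3 * f * ((val g3)^-1 * (val g2)^-1)
        = val g2 * (val g3 * f * (val g3)^-1) * (val g2)^-1 by rewrite !mulgA.
exact: G2_normalises_G1 (valP g2) (G3_normalises_G1 (valP g3) fG1).
Qed.

(** The conclusion is about the pair [x], not only about its value, so this
    also contains the fact that [G2] and [G3] meet trivially. *)
Lemma G23_meets_G1_trivially x : val23 x \in sgset (G1 R l) -> x = 1.
Proof.
case: x => g2 g3; rewrite /conj_sdprod_val /= inE => -[i [j]].
have := valP g2; rewrite inE => -[k [r g2E]].
case: (G3P (valP g3)) => g3E; last first.
  by rewrite g2E g3E => /pair_sym_mul_swap.
rewrite g3E mulg1 g2E => eq_ij.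
have [ki kj] : decim R k = shift R i /\ decim R (zu_sign r k) = shift R j.
  split; apply: symP => v.
    exact (congr1 (fun h : sym (T * T) => (h (v, v)).1) eq_ij).
  exact (congr1 (fun h : sym (T * T) => (h (v, v)).2) eq_ij).
congr pair; apply: val_inj => //=.
rewrite g2E eq_ij (shift_eq_decim (esym ki)) (shift_eq_decim (esym kj)).
exact: pair_sym1.
Qed.

Lemma sgset_GG : sgset (GG R l) = range (sdprod_val (nN := G23_normalises_G1)).
Proof.
pose prod3 (g1 : G1 R l) (g2 : G2 R l) (g3 : G3 R l) : sym (T * T) :=
  val g1 * (val g2 * val g3).
have range3 g1 g2 g3 :
    range (sdprod_val (nN := G23_normalises_G1)) (prod3 g1 g2 g3).
  by exists (g1, (g2, g3)).
apply/seteqP; split.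
  apply: smallest_sub; first exact: range_closed.
  move=> f [[fG|fG]|fG].
  - have := range3 (exist _ f (mem_set fG)) 1 1.
    by rewrite /prod3 /= !mulg1.
  - have := range3 1 (exist _ f (mem_set fG)) 1.
    by rewrite /prod3 /= mul1g mulg1.
  - have := range3 1 1 (exist _ f (mem_set fG)).
    by rewrite /prod3 /= !mul1g.
move=> _ [[g1 [g2 g3]] _ <-]; apply: set_mem.
have GGM := group_closedM (sgset_closed (GG R l)).
apply: (GGM (val g1) (val g2 * val g3)); last apply: GGM.
- by have := valP g1; rewrite !inE => g; apply: sub_gen_smallest; do 2!left.
- by have := valP g2; rewrite !inE => g; apply: sub_gen_smallest; left; right.
- by have := valP g3; rewrite !inE => g; apply: sub_gen_smallest; right.
Qed.

End Maps.

Theorem proposition2p9 (R : realType) (l : nat) (l_gt0 : (0 < l)%N) :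
  exists (n23 : normalised_by (G2 R l) (G3 R l))
         (n1 : normalises (@conj_sdprod_val _ _ _ n23) (G1 R l)),
    isomorphic (GG R l) (sdprod (conj_act n1)).
Proof.
exists (@G3_normalises_G2 R l), (@G23_normalises_G1 R l).
apply: isomorphic_range (@sgset_GG R l).
by apply: sdprod_val_inj => x; exact: G23_meets_G1_trivially.
Qed.
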